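(* Every uniform dessin d'enfant of genus $0$ is regular, and its automorphism group is isomorphic to its monodromy group and has order $n$, where $n$ is the number of edges of the dessin.
   Context: A dessin d'enfant (dessin) is a connected, finite, bipartite graph (vertices colored black and white, each edge joining a black vertex to a white vertex) embedded as a map in a connected, compact, oriented surface without boundary, so that every face is homeomorphic to a disk. Let $E$ be its set of edges and $n=|E|$. Let $x$ (resp. $y$) be the permutation of $E$ sending each edge $e$ to the next edge counterclockwise around the unique black (resp. white) vertex incident to $e$. The monodromy group is $G=\langle x,y\rangle\le \mathrm{Sym}(E)$; it acts transitively on $E$. Permutations act on the left and are composed from right to left. The cycles of $x$, $y$ and $(xy)^{-1}$ correspond to the black vertices, white vertices and faces, and the cycle lengths are their valencies. Conversely, any pair of permutations $x,y$ of an $n$-element set generating a transitive group arises in this way from a dessin. The passport of a dessin with $n$ edges is the triple $[\lambda_0,\lambda_1,\lambda_\infty]$ of partitions of $n$ given by the valencies of black vertices, white vertices and faces (equivalently the cycle types of $x$, $y$, $(xy)^{-1}$). The genus of the dessin is $g=\frac{n-(l(\lambda_0)+l(\lambda_1)+l(\lambda_\infty))}{2}+1$, where $l(\lambda)$ is the number of parts of $\lambda$. With $a^{p}$ denoting the partition with $p$ parts all equal to $a$, a dessin is uniform if its passport has the form $[a^{p},b^{q},c^{r}]$ with $n=pa=qb=rc$. A dessin is regular if its monodromy group acts freely (hence regularly) on $E$. The automorphism group of a dessin is the centralizer $C_{\mathrm{Sym}(E)}(G)$ of its monodromy group in $\mathrm{Sym}(E)$. *)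

(* Defs.v *)
From HB Require Import structures.
From mathcomp Require Import all_boot all_order all_algebra all_fingroup.

Set Implicit Arguments.
Unset Strict Implicit.
Unset Printing Implicit Defensive.

Import GroupScope.

(* A dessin is encoded by its permutation pair: [black] (resp. [white]) sends an
   edge to the next one counterclockwise around its black (resp. white) vertex.
   Connectedness of the underlying graph is transitivity of the group generated
   by the pair; MathComp's [transitive] forces the set of edges to be nonempty. *)
Record dessin := Dessin {
  edge : finType;
  black : {perm edge};
  white : {perm edge};
  dessin_trans : [transitive <<[set black; white]>>, on [set: edge] | 'P]
}.

Definition nb_edges (D : dessin) : nat := #|edge D|.

Definition monodromy (D : dessin) : {group {perm edge D}} :=
  <<[set black D; white D]>>%G.

(* This is (x y)^-1 for the right-to-left composition x o y: MathComp composes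
   permutations from left to right, (s * t) e = t (s e). *)
Definition face (D : dessin) : {perm edge D} := (white D * black D)^-1.

(* Partitions are written as nonincreasing sequences of parts; fixed points
   contribute parts equal to 1. *)
Definition cycle_type (T : finType) (s : {perm T}) : seq nat :=
  sort geq [seq #|pred_of_set c| | c <- enum (porbits s)].

Definition passport (D : dessin) : seq nat * seq nat * seq nat :=
  (cycle_type (black D), cycle_type (white D), cycle_type (face D)).

(* Rational-valued, so that the division by 2 is exact. *)
Definition genus (D : dessin) : rat :=
  let: (l0, l1, loo) := passport D in
  (((nb_edges D)%:R - (size l0 + size l1 + size loo)%N%:R) / 2%:R + 1)%R.

Definition uniform (D : dessin) : Prop :=
  exists a b c p q r : nat,
    [/\ passport D = (nseq p a, nseq q b, nseq r c),
        nb_edges D = (p * a)%N,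
        nb_edges D = (q * b)%N
      & nb_edges D = (r * c)%N].

(* The monodromy group acts freely: all edge stabilisers are trivial. *)
Definition regular (D : dessin) : Prop :=
  forall e : edge D, 'C_(monodromy D)[e | 'P] = 1.

Definition automorphism_group (D : dessin) : {group {perm edge D}} :=
  'C(monodromy D)%G.

(* Main.v *)
(** In genus 0 Euler's formula reads n/a + n/b + n/c = n + 2, so up to order
    (a, b, c) is (1, n, n), (2, 2, c), (2, 3, 3), (2, 3, 4) or (2, 3, 5).
    Enumerating the cosets of a cyclic subgroup of order at most c shows that the
    corresponding triangle relations x^a = y^b = (xy)^c = 1 force the group they
    generate to have at most n elements.  A transitive group on n points with at
    most n elements acts freely, and the centraliser of a regular permutation
    group consists of the translations on the other side, hence is isomorphic to
    it. *)

Require Import Defs.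
From mathcomp Require Import all_boot all_order all_algebra all_fingroup.
From mathcomp Require Import cyclic lra zify.

Set Implicit Arguments.
Unset Strict Implicit.
Unset Printing Implicit Defensive.

(** * Euler's formula and the spherical valency triples *)

Lemma euler_genus0 (D : dessin) (l0 l1 loo : seq nat) :
  passport D = (l0, l1, loo) -> genus D = 0%R ->
  size l0 + size l1 + size loo = (nb_edges D).+2.
Proof.
rewrite /genus => -> g0; apply/eqP; rewrite -(Num.Theory.eqr_nat rat).
rewrite -[_.+2]addn2 GRing.natrD; apply/eqP; move: g0; lra.
Qed.

(** If all valencies are at least 3, then p + q + r is at most n. For a = 2 the formula leaves q + r
    = n/2 + 2, which excludes b at least 4; for b = 3 it leaves r = n/6 + 2, which forces c < 6. *)
Lemma spherical_types (a b c p q r n : nat) :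
    0 < n -> n = p * a -> n = q * b -> n = r * c -> p + q + r = n.+2 ->
    a <= b <= c ->
  a = 1 /\ b = n \/
  a = 2 /\ [\/ b = 2 /\ n = c * 2, [/\ b = 3, c = 3 & n = 12],
               [/\ b = 3, c = 4 & n = 24] | [/\ b = 3, c = 5 & n = 60]].
Proof.
move=> n0 Ea Eb Ec E /andP[ab bc].
case: a => [|[|[|a]]] in Ea ab *; first by lia.
- have q0 : 0 < q by nia.
  have r0 : 0 < r by nia.
  have q1 : q = 1 by lia.
  by left; split=> //; rewrite Eb q1 mul1n.
- right; split=> //; have [b3|b3] := ltnP 3 b; first by nia.
  have [b2|b2] : b = 2 \/ b = 3 by lia.
    have r2 : r = 2 by lia.
    by constructor 1; split; rewrite // Ec r2 mulnC.
  subst b; have c5: c < 6 by nia.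
  case: c => [|[|[|[|[|[|c]]]]]] in Ec bc c5 *; try lia.
  + by constructor 2; split=> //; lia.
  + by constructor 3; split=> //; lia.
  + by constructor 4; split=> //; lia.
- nia.
Qed.

(** * Coset enumeration in the spherical triangle groups *)

Import GroupScope.

(** By induction on word length, every right coset of [<[s]>] is reached from [<[s]>] inside [S], so
    [size S] bounds the index. *)
Lemma card_gen2_coset_le (gT : finGroupType) (x s : gT) (S : seq {set gT}) :
    (<[s]> : {set gT}) \in S ->
    {in S, forall C, (C :* x \in S) && (C :* s \in S)} ->
  #|<<[set x; s]>>| <= #[s] * size S.
Proof.
move=> S_s closedS; set K := <<[set x; s]>>%G; rewrite -[<<_>>]/(K : {set gT}).
have sK : <[s]> \subset K by rewrite cycle_subG mem_gen // !inE eqxx orbT.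
rewrite -(Lagrange sK) leq_mul2l; apply/orP; right.
apply: leq_trans (card_size S); apply: subset_leq_card.
apply/subsetP=> _ /rcosetsP[g /gen_prodgP[n [c cP ->]] ->] {g}.
elim: n c cP => [|n IHn] c cP; first by rewrite big_ord0 rcoset1.
rewrite big_ord_recr /= rcosetM.
have /closedS/andP[Sx Ss] := IHn _ (fun i => cP (widen_ord (leqnSn n) i)).
by have := cP ord_max; rewrite !inE => /orP[] /eqP ->.
Qed.

Section InvolutionCosets.

Variables (gT : finGroupType) (x s : gT).
Hypothesis xx : x * x = 1.

Local Notation "'Hs' w" := (<[s]> :* w) (at level 10, w at level 8).

Let xV : x^-1 = x. Proof. by apply/eqP; rewrite eq_invg_mul xx. Qed.
Let xK u : u * x * x = u. Proof. by rewrite -mulgA xx mulg1. Qed.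

Let Hs_s w : Hs (s * w) = Hs w.
Proof. by rewrite rcosetM rcoset_id ?cycle_id. Qed.
Let Hs_sV w : Hs (s^-1 * w) = Hs w.
Proof. by rewrite rcosetM rcoset_id ?groupV ?cycle_id. Qed.

Let Hs_1 : Hs s = Hs 1. Proof. by rewrite -(Hs_s 1) mulg1. Qed.

Lemma dihedral_card : (x * s) ^+ 2 = 1 -> #|<<[set x; s]>>| <= #[s] * 2.
Proof.
rewrite !expgS expg0 mulg1 => xs2.
have Es : x * s = s^-1 * x.
  by rewrite -[x in RHS]xV -invMg; apply/esym/eqP; rewrite eq_invg_mul xs2.
pose S := [:: Hs 1; Hs x]; rewrite -[2]/(size S).
apply: card_gen2_coset_le; first by rewrite !inE rcoset1 eqxx.
apply/allP; rewrite /= !inE -!rcosetM !(mul1g, xx, Es, Hs_sV, Hs_1).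
by rewrite !eqxx ?orbT.
Qed.

Hypothesis xs3 : (x * s) ^+ 3 = 1.

(** This form of [xs3] brings a power of [s] out on the left, where a coset of [<[s]>] absorbs
    it. *)
Let conj_sV : x * s^-1 * x = s * x * s.
Proof.
rewrite -mulgA -[x in LHS]xV -!invMg; apply/eqP; rewrite eq_invg_mul -xs3.
by rewrite !expgS expg0 mulg1 !mulgA.
Qed.

Let conj_s : x * s * x = s^-1 * x * s^-1.
Proof. by apply: invg_inj; rewrite !invMg invgK xV !mulgA conj_sV. Qed.

(** Products are kept left-associated, so a relation must be restated behind an arbitrary prefix [u]
    for rewriting to find it inside a word. *)
Let conj_s_r u : u * x * s * x = u * s^-1 * x * s^-1.
Proof. by rewrite -2!mulgA [x * _]mulgA conj_s !mulgA. Qed.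
Let conj_sV_r u : u * x * s^-1 * x = u * s * x * s.
Proof. by rewrite -2!mulgA [x * _]mulgA conj_sV !mulgA. Qed.

Let conj_sVV : x * s^-1 * s^-1 * x = s * x * s * s * x * s.
Proof. by rewrite -[x * s^-1 in LHS]xK conj_sV conj_sV_r. Qed.

Let conj_sVV_r u : u * x * s^-1 * s^-1 * x = u * s * x * s * s * x * s.
Proof. by rewrite -3!mulgA [x * _]mulgA [x * _ * _]mulgA conj_sVV !mulgA. Qed.

Let Exs : Hs (x * s * x) = Hs (x * s^-1).
Proof. by rewrite conj_s -mulgA Hs_sV. Qed.
Let ExV : Hs (x * s^-1 * x) = Hs (x * s).
Proof. by rewrite conj_sV -mulgA Hs_s. Qed.

Lemma tetrahedral_card : s ^+ 3 = 1 -> #|<<[set x; s]>>| <= #[s] * 4.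
Proof.
rewrite !expgS expg0 mulg1 => s3.
have ss u : u * s * s = u * s^-1.
  by apply: (mulIg s); rewrite mulgKV -!mulgA s3 mulg1.
(* Vertices of a tetrahedron: the base vertex and its three neighbours. *)
pose S := [:: Hs 1; Hs x; Hs (x * s); Hs (x * s^-1)]; rewrite -[4]/(size S).
apply: card_gen2_coset_le; first by rewrite !inE rcoset1 eqxx.
apply/allP; rewrite /= !inE -!rcosetM !(mul1g, xx, Exs, ExV, Hs_1, ss, mulgKV).
by rewrite !eqxx ?orbT.
Qed.

Lemma octahedral_card : s ^+ 4 = 1 -> #|<<[set x; s]>>| <= #[s] * 6.
Proof.
rewrite !expgS expg0 mulg1 => s4.
have sss u : u * s * s * s = u * s^-1.
  by apply: (mulIg s); rewrite mulgKV -!mulgA s4 mulg1.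
have sVV u : u * s^-1 * s^-1 = u * s * s by rewrite -(sss (u * s^-1)) mulgKV.
(* The cosets are the vertices of an octahedron: the base vertex, its four neighbours [Hs (x * s^i)]
   and the antipode, which is fixed by [s]. *)
have Epole : Hs (x * s * s * x * s) = Hs (x * s * s * x).
  by rewrite -[in RHS]sVV conj_sVV -!mulgA Hs_s.
pose S := [:: Hs 1; Hs x; Hs (x * s); Hs (x * s^-1); Hs (x * s * s);
              Hs (x * s * s * x)].
rewrite -[6]/(size S); apply: card_gen2_coset_le; first by rewrite !inE rcoset1 eqxx.
apply/allP; rewrite /= !inE -!rcosetM.
rewrite !(mul1g, xx, Exs, ExV, Epole, xK, Hs_1, sss, mulgKV).
by rewrite !eqxx ?orbT.
Qed.

Lemma icosahedral_card : s ^+ 5 = 1 -> #|<<[set x; s]>>| <= #[s] * 12.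
Proof.
rewrite !expgS expg0 mulg1 => s5.
have sss u : u * s * s * s = u * s^-1 * s^-1.
  by apply: (mulIg s); rewrite mulgKV; apply: (mulIg s);
    rewrite mulgKV -!mulgA s5 mulg1.
(* The cosets correspond to the vertices of an icosahedron: the base vertex, its
   five neighbours Hs (x * s^i), the five Hs (w * s^i), and the antipode, which
   E5 shows to be fixed by s.  Naming w by [move] keeps [mulgA] from seeing
   through it. *)
move wE : (x * s * s * x) => w.
have E1 : Hs (x * s^-1 * s^-1 * x) = Hs (w * s).
  by rewrite conj_sVV -wE -!mulgA Hs_s.
have E2 : Hs (w * s * x) = Hs (x * s^-1 * s^-1).
  by rewrite -wE conj_s_r mulgK conj_s -2!mulgA Hs_sV mulgA.
have E3' : w * s^-1 * x = s * w * s * s.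
  by rewrite -wE conj_sV_r sss conj_sVV !mulgA.
have E3 : Hs (w * s^-1 * x) = Hs (w * s * s) by rewrite E3' -!mulgA Hs_s.
have E4 : Hs (w * s * s * x) = Hs (w * s^-1).
  (* Prefixing [s] leaves the coset unchanged and exposes the right side of [E3'], after which the
     two [x] cancel. *)
  by rewrite -(Hs_s (_ * x)) !mulgA -E3' xK.
have E5 : Hs (w * s^-1 * s^-1 * x * s) = Hs (w * s^-1 * s^-1 * x).
  set v := w * s^-1 * s^-1 * x.
  suff {2}-> : v = s * (v * s) by rewrite Hs_s.
  by rewrite /v -wE {1}conj_sVV_r sss conj_sVV sss !mulgA.
pose S := [:: Hs 1; Hs x; Hs (x * s); Hs (x * s^-1); Hs (x * s * s);
              Hs (x * s^-1 * s^-1); Hs w; Hs (w * s); Hs (w * s^-1);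
              Hs (w * s * s); Hs (w * s^-1 * s^-1); Hs (w * s^-1 * s^-1 * x)].
have wx : w * x = x * s * s by rewrite -wE xK.
rewrite -[12]/(size S); apply: card_gen2_coset_le; first by rewrite !inE rcoset1 eqxx.
apply/allP; rewrite /= !inE -!rcosetM wE.
rewrite !(mul1g, xx, Exs, ExV, E1, E2, E3, E4, E5, wx, xK, Hs_1, sss, mulgKV).
by rewrite !eqxx ?orbT.
Qed.

End InvolutionCosets.

(** * Order bound for groups generated by a spherical triple *)

Lemma sorted_spherical_card (gT : finGroupType) (x y z : gT)
    (a b c p q r n : nat) :
    x * y * z = 1 -> x ^+ a = 1 -> y ^+ b = 1 -> z ^+ c = 1 ->
    0 < n -> n = (p * a)%N -> n = (q * b)%N -> n = (r * c)%N ->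
    (p + q + r)%N = n.+2 -> a <= b <= c ->
  #|<<[set x; y]>>| <= n.
Proof.
move=> xyz xa yb zc n0 Ea Eb Ec E abc.
have le_order (g : gT) m : 0 < m -> g ^+ m = 1 -> #[g] <= m.
  by move=> m0 gm; rewrite dvdn_leq // order_dvdn gm.
have [[a1 bn]|[a2 abE]] := spherical_types n0 Ea Eb Ec E abc.
- subst a b; rewrite expg1 in xa; rewrite xa.
  apply: leq_trans (le_order _ _ n0 yb); apply: subset_leq_card.
  by rewrite gen_subG; apply/subsetP=> g; rewrite !inE => /orP[] /eqP ->;
    rewrite ?group1 ?cycle_id.
(* The generators are changed from [x, y] to [x, s]: here [s] is the inverse of [z], and
   [x * s = y], so the exponent b becomes the relation on [x * s]. *)
subst a; set s := x * y; have xx : x * x = 1 by rewrite -[RHS]xa expgS expg1.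
have sub : <<[set x; y]>> \subset <<[set x; s]>>.
  have xS : x \in <<[set x; s]>> by rewrite mem_gen // !inE eqxx.
  have sS : s \in <<[set x; s]>> by rewrite mem_gen // !inE eqxx orbT.
  rewrite gen_subG; apply/subsetP=> g; rewrite !inE => /orP[] /eqP -> //.
  by rewrite -[y](mulKg x) groupM ?groupV.
have xsE : x * s = y by rewrite mulgA xx mul1g.
have sc : s ^+ c = 1.
  by apply: invg_inj; rewrite -expVgn invg1 -zc; congr (_ ^+ _); apply/eqP;
    rewrite eq_invg_mul xyz.
(* c = 0 would make [s ^+ c = 1] vacuous, but it contradicts [0 < n]. *)
have os : #[s] <= c by apply: le_order sc; case: (c) Ec n0 => // ->; rewrite muln0.
apply: leq_trans (subset_leq_card sub) _.
case: abE => [[b2 ->]|[b3 c3 ->]|[b3 c4 ->]|[b3 c5 ->]]; subst b; try subst c.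
- by apply: leq_trans (dihedral_card xx _) _; rewrite ?xsE // leq_mul2r os orbT.
- by apply: leq_trans (tetrahedral_card xx _ sc) _; rewrite ?xsE //; lia.
- by apply: leq_trans (octahedral_card xx _ sc) _; rewrite ?xsE //; lia.
- by apply: leq_trans (icosahedral_card xx _ sc) _; rewrite ?xsE //; lia.
Qed.

Lemma gen_rot (gT : finGroupType) (x y z : gT) :
  x * y * z = 1 -> <<[set x; y]>> \subset <<[set y; z]>>.
Proof.
move=> xyz; have yS : y \in <<[set y; z]>> by rewrite mem_gen // !inE eqxx.
have zS : z \in <<[set y; z]>> by rewrite mem_gen // !inE eqxx orbT.
rewrite gen_subG; apply/subsetP=> g; rewrite !inE => /orP[] /eqP -> //.
have -> : x = (y * z)^-1.
  by apply/eqP; rewrite -eqg_invLR eq_invg_mul mulgA xyz.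
by rewrite groupV groupM.
Qed.

Lemma gen_rev (gT : finGroupType) (x y z : gT) :
  x * y * z = 1 -> <<[set x; y]>> \subset <<[set z^-1; y^-1]>>.
Proof.
move=> /gen_rot/subset_trans; apply; rewrite gen_subG.
by apply/subsetP=> g; rewrite !inE => /orP[] /eqP ->;
  rewrite -groupV mem_gen // !inE eqxx ?orbT.
Qed.

Lemma spherical_card (gT : finGroupType) (x y z : gT)
    (a b c p q r n : nat) :
    x * y * z = 1 -> x ^+ a = 1 -> y ^+ b = 1 -> z ^+ c = 1 ->
    0 < n -> n = (p * a)%N -> n = (q * b)%N -> n = (r * c)%N ->
    (p + q + r)%N = n.+2 ->
  #|<<[set x; y]>>| <= n.
Proof.
move=> xyz xa yb zc n0 Ea Eb Ec E.
(* Rotating (x, y, z), or reversing it with inverses, keeps the product 1 and does not shrink the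
   generated group. These two moves reach every ordering of the exponents, hence the sorted one. *)
pose bound a b c p q r := forall x y z : gT,
  x * y * z = 1 -> x ^+ a = 1 -> y ^+ b = 1 -> z ^+ c = 1 ->
    n = (p * a)%N -> n = (q * b)%N -> n = (r * c)%N ->
    (p + q + r)%N = n.+2 -> #|<<[set x; y]>>| <= n.
have sorted a' b' c' p' q' r' : a' <= b' <= c' -> bound a' b' c' p' q' r'.
  move=> abc x' y' z' *.
  exact: (@sorted_spherical_card _ x' y' z' a' b' c' p' q' r').
have rot a' b' c' p' q' r' : bound b' c' a' q' r' p' -> bound a' b' c' p' q' r'.
  move=> B x' y' z' xyz' xa' yb' zc' Ea' Eb' Ec' E'.
  apply: leq_trans (subset_leq_card (gen_rot xyz')) _.
  apply: (B _ _ x') => //; last by lia.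
  by apply: (mulgI x'); rewrite !mulgA xyz' mul1g mulg1.
have rev a' b' c' p' q' r' : bound c' b' a' r' q' p' -> bound a' b' c' p' q' r'.
  move=> B x' y' z' xyz' xa' yb' zc' Ea' Eb' Ec' E'.
  apply: leq_trans (subset_leq_card (gen_rev xyz')) _.
  apply: (B _ _ x'^-1) => //; rewrite ?expVgn ?xa' ?yb' ?zc' ?invg1 //; last by lia.
  by rewrite -!invMg mulgA xyz' invg1.
suff B : bound a b c p q r by apply: (B x y z).
have [ab|ba] := leqP a b; have [bc|cb] := leqP b c; have [ac|ca] := leqP a c.
- by apply: sorted; lia.
- by lia.
- by apply/rot/rev/sorted; lia.
- by apply/rot/rot/sorted; lia.
- by apply/rev/rot/sorted; lia.
- by apply/rot/sorted; lia.
- by lia.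
- by apply/rev/sorted; lia.
Qed.

(** * Exponents from cycle types, and freeness by orbit-stabiliser *)

Lemma cycle_type_nseq (T : finType) (s : {perm T}) p a :
  cycle_type s = nseq p a -> s ^+ a = 1.
Proof.
move=> ct; apply/permP=> e; have : #|porbit s e| \in cycle_type s.
  by rewrite mem_sort; apply/mapP; exists (porbit s e); rewrite // mem_enum imset_f.
by rewrite ct => /nseqP[<- _]; rewrite permX perm1 iter_porbit.
Qed.

Lemma regular_of_card_le (D : dessin) :
  #|monodromy D| <= nb_edges D -> regular D.
Proof.
move=> leGn e; apply: card_le1_trivg.
have := card_orbit_stab 'P (monodromy D) e.
rewrite (atransP (dessin_trans D)) ?inE // cardsT.
have : 0 < #|edge D| by apply/card_gt0P; exists e.
by move=> n0 En; rewrite -(leq_pmul2l n0) muln1 En.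
Qed.

(** * The centraliser of a regular permutation group *)

Section Centraliser.

Variables (T : finType) (G : {group {perm T}}) (e0 : T).
Hypothesis G_trans : [transitive G, on [set: T] | 'P].
Hypothesis G_free : forall e, 'C_G[e | 'P] = 1.

Lemma free_perm_inj g h e : g \in G -> h \in G -> g e = h e -> g = h.
Proof.
move=> Gg Gh gh; apply/eqP; rewrite eq_mulgV1; apply/eqP/set1gP.
rewrite -(G_free e) inE groupM ?groupV //=; apply/astab1P.
by rewrite /= apermE permM gh permK.
Qed.

Let move_exists e : exists g, (g \in G) && (g e0 == e).
Proof.
have /imsetP[g Gg ->] : e \in orbit 'P G e0 by rewrite (atransP G_trans) ?inE.
by exists g; rewrite Gg /= apermE.
Qed.

Let h e := xchoose (move_exists e).

Let hG e : h e \in G. Proof. by have /andP[] := xchooseP (move_exists e). Qed.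
Let he e : h e e0 = e. Proof. by have /andP[_ /eqP] := xchooseP (move_exists e). Qed.
Let h_eq g e : g \in G -> g e0 = e -> h e = g.
Proof. by move=> Gg ge; apply: (@free_perm_inj _ _ e0); rewrite ?hG ?he. Qed.

Let cG c g e : c \in 'C(G) -> g \in G -> c (g e) = g (c e).
Proof. by move=> Cc Gg; rewrite -!permM (centP Cc). Qed.

(* The inverse makes phi a morphism rather than an antimorphism. *)
Let phi (c : {perm T}) := (h (c e0))^-1.

Let phiM : {in 'C(G) &, {morph phi : c d / c * d}}.
Proof.
move=> c d Cc Cd; rewrite /phi -invMg; congr _^-1.
by apply: h_eq; rewrite ?groupM ?hG // !permM he -[c e0 in RHS]he (cG _ Cd) ?hG.
Qed.

Lemma cent_regular_isog : 'C(G) \isog G.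
Proof.
apply/isogP; exists (Morphism phiM).
  apply/injmP => c d Cc Cd /= /invg_inj hcd; apply/permP => e.
  by rewrite -[e]he !(cG _ _ (hG e)) // -[c e0]he -[d e0]he hcd.
apply/setP=> g; apply/idP/idP => [/morphimP[c _ _ ->]|Gg].
  by rewrite groupV hG.
(* Preimage of g: with e identified with [h e], G acts by right multiplication and [f] is left
   multiplication by [g^-1], so they commute. *)
pose f e := h e (g^-1 e0).
have f_inj : injective f.
  by move=> d e /(free_perm_inj (hG d) (hG e)) hde; rewrite -[d]he hde he.
have Cf : perm f_inj \in 'C(G).
  apply/centP=> k Gk; apply/permP=> e; rewrite !permM !permE /f.
  by rewrite (@h_eq (h e * k) (k e)) ?groupM ?hG // permM ?he.
have <- : phi (perm f_inj) = g.
  by rewrite /phi permE /f (@h_eq 1 e0) ?perm1 // (@h_eq g^-1) ?groupV ?invgK.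
exact: (mem_morphim (Morphism phiM) Cf Cf).
Qed.

End Centraliser.

Theorem proposition4p1 (D : dessin) (D_uniform : uniform D)
    (D_genus0 : genus D = 0%R) :
  [/\ regular D,
      (automorphism_group D \isog monodromy D)%g
    & #|automorphism_group D| = nb_edges D].
Proof.
have [e0 _ _] := imsetP (dessin_trans D).
case: D_uniform => a [b [c [p [q [r [pass Ea Eb Ec]]]]]].
have E : (p + q + r)%N = (nb_edges D).+2.
  by have := euler_genus0 pass D_genus0; rewrite !size_nseq.
have D_regular : regular D.
  apply: regular_of_card_le; case: pass.
  move=> /cycle_type_nseq xa /cycle_type_nseq yb /cycle_type_nseq zc.
  (* [face D] is the inverse of [white D * black D], so white must come first for the triple to have
     product 1. *)
  rewrite /monodromy /= setUC.
  apply: (@spherical_card _ (white D) (black D) (face D) b a c q p r) => //; last by lia.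
  - by rewrite mulgV.
  - by apply/card_gt0P; exists e0.
have iso : (automorphism_group D \isog monodromy D)%g.
  exact: cent_regular_isog e0 (dessin_trans D) D_regular.
split=> //; rewrite (card_isog iso).
have := card_orbit_stab 'P (monodromy D) e0.
by rewrite (atransP (dessin_trans D)) ?inE // D_regular cards1 muln1 cardsT.
Qed.
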